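(* Let $X$ be a real Banach space, let $\tau$ be either the norm topology or the weak topology of $X$, let $V$ be a $\tau$-closed subset of $X$, and let $\mathcal{A}$ be a family of nonempty finite subsets of $X$. Let $\mathscr{F}_{cm}$ denote the class of all convex monotone functions $f:\ell_\infty^+(F)\to[0,\infty)$, $F\in\mathcal{A}$. Then the triplet $(X,V,\mathcal{A})$ has $\tau$-$\mathscr{F}_{cm}$-SACP if and only if $(X,V,\mathcal{A})$ has the $\tau$-$\mathscr{F}_{cm}$-property-$(P_1)$ and $\mathrm{Cent}_V^f(F)$ is $\tau$-compact for every $F\in\mathcal{A}$ and every $f:\ell_\infty^+(F)\to[0,\infty)$ in $\mathscr{F}_{cm}$.
   Context: For a nonempty closed bounded set $F\subseteq X$, $\ell_\infty^+(F)$ is the set of bounded functions $\varphi:F\to[0,\infty)$, ordered coordinatewise ($\varphi_1\le\varphi_2$ iff $\varphi_1(t)\le\varphi_2(t)$ for all $t\in F$); for finite $F$ this is identified with $[0,\infty)^{card(F)}$. A function $f:\ell_\infty^+(F)\to[0,\infty)$ is monotone if $\varphi_1\le\varphi_2$ implies $f(\varphi_1)\le f(\varphi_2)$. For $x\in X$ and $V\subseteq X$: $r_f(x,F)=f((\|x-a\|)_{a\in F})$, $\mathrm{rad}_V^f(F)=\inf_{v\in V}r_f(v,F)$, $\mathrm{Cent}_V^f(F)=\{v\in V: r_f(v,F)=\mathrm{rad}_V^f(F)\}$, and for $\delta>0$, $\delta\text{-}\mathrm{Cent}_V^f(F)=\{v\in V: r_f(v,F)\le \mathrm{rad}_V^f(F)+\delta\}$.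 For a family $\mathfrak{F}$ of such sets and a class $\mathscr{F}$ of such functions: $(X,V,\mathfrak{F})$ has $\tau$-$\mathscr{F}$-property-$(P_1)$ if for all $F\in\mathfrak{F}$ and all $f\in\mathscr{F}$ defined on $\ell_\infty^+(F)$, $\mathrm{Cent}_V^f(F)\neq\emptyset$ and for every $\tau$-neighbourhood $W$ of $0$ there is $\delta>0$ with $\delta\text{-}\mathrm{Cent}_V^f(F)\subseteq \mathrm{Cent}_V^f(F)+W$. $(X,V,\mathfrak{F})$ has $\tau$-$\mathscr{F}$-SACP if for all $F\in\mathfrak{F}$, all $f\in\mathscr{F}$ defined on $\ell_\infty^+(F)$ and every sequence $(v_n)\subseteq V$ with $r_f(v_n,F)\to\mathrm{rad}_V^f(F)$, the sequence $(v_n)$ has a $\tau$-convergent subsequence. *)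

(* Defs.v *)
From HB Require Import structures.
From mathcomp Require Import all_boot all_order all_algebra.
From mathcomp Require Import finmap.
From mathcomp Require Import all_classical all_reals all_analysis.
Import Order.TTheory GRing.Theory Num.Theory.
Import numFieldNormedType.Exports.

Set Implicit Arguments.
Unset Strict Implicit.
Unset Printing Implicit Defensive.

Local Open Scope classical_set_scope.
Local Open Scope ring_scope.

Inductive topo := NormTop | WeakTop.

Section Defs.
Context {R : realType} {X : normedModType R}.

Definition cont_lin (phi : X -> R) : Prop :=
  (forall (a : R) (x y : X), phi (a *: x + y) = a * phi x + phi y)
  /\ continuous phi.

Definition weak_open (U : set X) : Prop :=
  forall x, U x -> exists (n : nat) (phi : 'I_n -> X -> R),
    (forall i, cont_lin (phi i)) /\
    exists2 e : R, 0 < e & [set y | forall i, `|phi i (y - x)| < e] `<=` U.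

Definition tau_open (t : topo) (U : set X) : Prop :=
  match t with NormTop => open U | WeakTop => weak_open U end.

Definition tau_closed (t : topo) (C : set X) : Prop := tau_open t (~` C).

Definition tau_nbhs0 (t : topo) (W : set X) : Prop :=
  exists U, [/\ tau_open t U, U 0 & U `<=` W].

Definition tau_cvg (t : topo) (u : nat -> X) (x : X) : Prop :=
  forall U, tau_open t U -> U x -> \forall n \near \oo, U (u n).

Definition tau_compact (t : topo) (K : set X) : Prop :=
  forall (I : Type) (U : I -> set X), (forall i, tau_open t (U i)) ->
    K `<=` \bigcup_i U i ->
    exists (n : nat) (g : 'I_n -> I), forall x, K x -> exists k, U (g k) x.

(* elements of l_infty^+(F), F finite: nonnegative functions on F *)
Definition nonneg_vec (F : {fset X}) (p : F -> R) : Prop := forall a, 0 <= p a.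

Definition cm_fun (F : {fset X}) (f : (F -> R) -> R) : Prop :=
  [/\ (forall p, nonneg_vec p -> 0 <= f p),
      (forall p q, nonneg_vec p -> nonneg_vec q -> (forall a, p a <= q a) ->
         f p <= f q) &
      (forall p q (s : R), nonneg_vec p -> nonneg_vec q -> 0 <= s <= 1 ->
         f (fun a => s * p a + (1 - s) * q a) <= s * f p + (1 - s) * f q)].

Definition rf (F : {fset X}) (f : (F -> R) -> R) (x : X) : R :=
  f (fun a : F => `|x - val a|).

Definition rad (V : set X) (F : {fset X}) (f : (F -> R) -> R) : R :=
  inf [set rf f v | v in V].

Definition Cent (V : set X) (F : {fset X}) (f : (F -> R) -> R) : set X :=
  [set v | V v /\ rf f v = rad V f].

Definition dCent (V : set X) (F : {fset X}) (f : (F -> R) -> R) (d : R) : set X :=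
  [set v | V v /\ rf f v <= rad V f + d].

Definition P1 (t : topo) (V : set X) (A : set {fset X}) : Prop :=
  forall F, A F -> forall f : (F -> R) -> R, cm_fun f ->
    Cent V f !=set0 /\
    forall W, tau_nbhs0 t W -> exists2 d : R, 0 < d &
      dCent V f d `<=` [set z | exists c w, [/\ Cent V f c, W w & z = c + w]].

Definition SACP (t : topo) (V : set X) (A : set {fset X}) : Prop :=
  forall F, A F -> forall f : (F -> R) -> R, cm_fun f ->
    forall v : nat -> X, (forall n, V (v n)) ->
      (fun n => rf f (v n)) @ \oo --> rad V f ->
      exists phi : nat -> nat, (forall n, (phi n < phi n.+1)%N) /\
        exists x, tau_cvg t (v \o phi) x.

End Defs.

(* Main.v *)
(**
  If [A] is empty both sides are void.  Otherwise the zero function is convex and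
  monotone and makes [Cent] equal to [V], so SACP forces [V] to be sequentially
  tau-compact and the right-hand side forces [V] to be tau-compact.  These agree
  by the Eberlein-Smulian theorem (a metric-space fact for the norm topology).
  Moreover, for finite [F], [rf f] is tau-lower semicontinuous whenever [f] is
  convex and monotone, so tau-limits of minimizing sequences are centers: this
  gives property (P1) and, with constant values, compactness of [Cent].
*)
Require Import Defs.
From HB Require Import structures.
From mathcomp Require Import all_boot all_order all_algebra.
From mathcomp Require Import finmap.
From mathcomp Require Import all_classical all_reals all_analysis.
From mathcomp Require Import lra.

Import Order.TTheory GRing.Theory Num.Theory.
Import numFieldNormedType.Exports.

Local Open Scope classical_set_scope.
Local Open Scope ring_scope.

(** * Sublinear functionals and the Hahn-Banach theorem *)

Section HahnBanach.
Context {R : realType} {X : lmodType R}.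
Implicit Types p : X -> R.

Definition sublinear p : Prop :=
  (forall x y, p (x + y) <= p x + p y) /\
  (forall (a : R) x, 0 <= a -> p (a *: x) <= a * p x).

Lemma sublinear_scale {p} (sp : sublinear p) (a : R) x :
  0 <= a -> p (a *: x) = a * p x.
Proof.
case: sp => pD pZ a0; apply/eqP; rewrite eq_le pZ //=.
have [->|an0] := eqVneq a 0.
  have := pD 0 0; rewrite scale0r mul0r addr0; lra.
have ap : 0 < a by rewrite lt_neqAle eq_sym an0.
have := pZ a^-1 (a *: x); rewrite scalerA mulVf // scale1r invr_ge0 => /(_ a0).
by rewrite -ler_pdivlMl.
Qed.

Lemma sublinear_opp {p} (sp : sublinear p) x : - p (- x) <= p x.
Proof.
have := sp.1 x (- x); rewrite subrr.
have := sublinear_scale sp 0 x (lexx _); rewrite scale0r mul0r => ->; lra.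
Qed.

(** Oddness turns subadditivity, applied to [(x + y) + (- y)], into the reverse inequality. *)
Lemma sublinear_linear {p} (sp : sublinear p) :
  (forall x, p (- x) <= - p x) ->
  forall (a : R) x y, p (a *: x + y) = a * p x + p y.
Proof.
move=> pN.
have pNE x : p (- x) = - p x.
  by apply/eqP; rewrite eq_le pN /=; have := sublinear_opp sp x; lra.
have pD x y : p (x + y) = p x + p y.
  apply/eqP; rewrite eq_le sp.1 /=.
  by have := sp.1 (x + y) (- y); rewrite addrK pNE; lra.
move=> a x y; rewrite pD; congr (_ + _).
have [a0|a0] := leP 0 a; first exact: sublinear_scale.
have := sublinear_scale sp (- a) x; rewrite scaleNr pNE oppr_ge0 => /(_ (ltW a0)).
lra.
Qed.

(** For sublinear [p], a sublinear minorant that is at most [- p x] at [- x]; a linear functional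
    below it therefore takes the value [p x] at [x]. *)
Definition tilt p (x y : X) : R :=
  inf [set p (y + t *: x) - t * p x | t in [set t | 0 <= t]].

Lemma tilt_le {p} (sp : sublinear p) x y (t : R) :
  0 <= t -> tilt p x y <= p (y + t *: x) - t * p x.
Proof.
move=> t0; apply: ge_inf; last by exists t.
(* The infimum is over a set bounded below, since [p (s *: x) <= p (y + s *: x) + p (- y)]. *)
exists (- p (- y)) => _ [s /= s0 <-].
have := sp.1 (y + s *: x) (- y); rewrite addrC addKr.
by rewrite (sublinear_scale sp) //; lra.
Qed.

Lemma le_tilt p x y (c : R) :
  (forall t, 0 <= t -> c <= p (y + t *: x) - t * p x) -> c <= tilt p x y.
Proof.
move=> H; apply: lb_le_inf; last by move=> _ [t t0 <-]; exact: H.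
by exists (p (y + 0 *: x) - 0 * p x); exists 0 => //=.
Qed.

Lemma tilt_le_self {p} (sp : sublinear p) x y : tilt p x y <= p y.
Proof.
by have := tilt_le sp x y 0 (lexx _); rewrite scale0r addr0 mul0r subr0.
Qed.

Lemma tilt_opp {p} (sp : sublinear p) x : tilt p x (- x) <= - p x.
Proof.
have := tilt_le sp x (- x) 1 ler01; rewrite scale1r addNr mul1r.
by have := sublinear_scale sp 0 x (lexx _); rewrite scale0r mul0r => ->; rewrite sub0r.
Qed.

(** Parameters [t] for [y] and [s] for [z] combine to [t + s] for [y + z]; for positive [a], [t] for
    [y] corresponds to [a * t] for [a *: y]. *)
Lemma sublinear_tilt {p} (sp : sublinear p) x : sublinear (tilt p x).
Proof.
split=> [y z|a y a0].
  have H s : 0 <= s -> tilt p x (y + z) - (p (z + s *: x) - s * p x) <= tilt p x y.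
    move=> s0; apply: le_tilt => t t0.
    have := tilt_le sp x (y + z) (t + s) (addr_ge0 t0 s0).
    have := sp.1 (y + t *: x) (z + s *: x).
    by rewrite scalerDl addrACA; lra.
  suff : tilt p x (y + z) - tilt p x y <= tilt p x z by lra.
  by apply: le_tilt => s s0; have := H s s0; lra.
have [->|an0] := eqVneq a 0.
  have := tilt_le_self sp x 0; rewrite scale0r mul0r.
  by have := sublinear_scale sp 0 x (lexx _); rewrite scale0r mul0r => ->.
have ap : 0 < a by rewrite lt_neqAle eq_sym an0.
rewrite -ler_pdivrMl //; apply: le_tilt => t t0.
rewrite ler_pdivrMl //.
have := tilt_le sp x (a *: y) (a * t) (mulr_ge0 a0 t0).
by rewrite -scalerA -scalerDr (sublinear_scale sp) //; lra.
Qed.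

(* The infimum of a chain of sublinear functionals below [p] is sublinear, so
   Zorn yields a minimal one; being equal to all of its tilts, it is odd. *)
Lemma exists_linear_below {p} : sublinear p ->
  exists f : X -> R, (forall (a : R) x y, f (a *: x + y) = a * f x + f y) /\
    (forall x, f x <= p x).
Proof.
move=> sp.
pose T := {q : X -> R | sublinear q /\ forall x, q x <= p x}.
pose t0 : T := exist _ p (conj sp (fun x => lexx _)).
(* The order is reversed, so a maximal element is a pointwise minimal functional. *)
pose r (q1 q2 : T) := `[< forall x, sval q2 x <= sval q1 x >].
have [|||[m [sm mp]] mmin] := @ZL_preorder T t0 r.
- by move=> t; apply/asboolP.
- move=> a b c /asboolP ab /asboolP bc; apply/asboolP => x.
  exact: le_trans (bc x) (ab x).
- move=> A Atot.
  have [[q0 Aq0]|A0] := pselect (A !=set0); last first.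
    by exists t0 => s As; exfalso; apply: A0; exists s.
  pose g x := inf [set sval q x | q in A].
  have g_le q x : A q -> g x <= sval q x.
    move=> Aq; apply: ge_inf; last by exists q.
    exists (- p (- x)) => _ [s As <-].
    by case: s {As} => s [ss sle] /=; have := sublinear_opp ss x; have := sle (- x); lra.
  have le_g x c : (forall q, A q -> c <= sval q x) -> c <= g x.
    move=> H; apply: lb_le_inf; first by exists (sval q0 x), q0.
    by move=> _ [q Aq <-]; exact: H.
  have sg : sublinear g.
    split=> [x y|a x a0].
      suff : g (x + y) - g x <= g y by lra.
      apply: (le_g) => q2 Aq2.
      suff : g (x + y) - sval q2 y <= g x by lra.
      apply: (le_g) => q1 Aq1.
      (* In a chain the smaller of [q1] and [q2] serves for both summands. *)
      case: (Atot _ _ Aq1 Aq2) => /asboolP H.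
        have := g_le _ (x + y) Aq2; have := (svalP q2).1.1 x y; have := H x; lra.
      have := g_le _ (x + y) Aq1; have := (svalP q1).1.1 x y; have := H y; lra.
    have [a00|an0] := eqVneq a 0.
      have := g_le _ (a *: x) Aq0.
      by rewrite (sublinear_scale (svalP q0).1) // a00 !mul0r.
    have ap : 0 < a by rewrite lt_neqAle eq_sym an0.
    rewrite -ler_pdivrMl //; apply: (le_g) => q Aq; rewrite ler_pdivrMl //.
    by rewrite -(sublinear_scale (svalP q).1) //; exact: g_le.
  have gp x : g x <= p x by apply: le_trans (g_le q0 x Aq0) ((svalP q0).2 x).
  by exists (exist _ g (conj sg gp)) => s As; apply/asboolP => x /=; exact: g_le.
exists m; split=> //; apply: sublinear_linear => // x.
have tp y : tilt m x y <= p y by exact: le_trans (tilt_le_self sm x y) (mp y).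
have := mmin (exist _ (tilt m x) (conj (sublinear_tilt sm x) tp)).
move=> /(_ _)/asboolP H; have {}H : forall y, m y <= tilt m x y.
  by apply: H; apply/asboolP => y /=; exact: tilt_le_self.
exact: le_trans (H _) (tilt_opp sm x).
Qed.

Lemma lin0 {f : X -> R} :
  (forall (a : R) x y, f (a *: x + y) = a * f x + f y) -> f 0 = 0.
Proof. by move=> fL; have := fL 1 0 0; rewrite scale1r addr0; lra. Qed.

Lemma linB {f : X -> R} :
  (forall (a : R) x y, f (a *: x + y) = a * f x + f y) ->
  forall x y, f (x - y) = f x - f y.
Proof. by move=> fL x y; rewrite addrC -scaleN1r fL; lra. Qed.

Lemma hahn_banach {p} (x : X) : sublinear p ->
  exists f : X -> R, [/\ (forall (a : R) y z, f (a *: y + z) = a * f y + f z),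
    (forall y, f y <= p y) & f x = p x].
Proof.
move=> sp; have [f [fL fle]] := exists_linear_below (sublinear_tilt sp x).
have fp y : f y <= p y by exact: le_trans (fle y) (tilt_le_self sp x y).
exists f; split=> //; apply/eqP; rewrite eq_le fp /=.
have := le_trans (fle (- x)) (tilt_opp sp x).
by have := fL (-1) x 0; rewrite addr0 scaleN1r (lin0 fL); lra.
Qed.

End HahnBanach.

(** * Contractive functionals and separation *)

Section Functionals.
Context {R : realType} {X : normedModType R}.

(** The closed unit ball of the dual; continuity follows from the norm bound. *)
Definition contraction_lin (f : X -> R) : Prop :=
  (forall (a : R) x y, f (a *: x + y) = a * f x + f y) /\
  (forall x, `|f x| <= `|x|).

Lemma contraction_cont_lin f : contraction_lin f -> cont_lin f.
Proof.
move=> [fL fle]; split=> // x; apply/cvgrPdist_lt => e e0.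
apply/nbhs_ballP; exists e => //= y; rewrite -ball_normE /= => xy.
by rewrite -(linB fL); exact: le_lt_trans (fle _) xy.
Qed.

Definition dist_to (S : set X) (x : X) : R := inf [set `|x - u| | u in S].

Lemma dist_to_le (S : set X) x u : S u -> dist_to S x <= `|x - u|.
Proof.
by move=> Su; apply: ge_inf; [exists 0 => _ [? _ <-] | exists u].
Qed.

Lemma le_dist_to (S : set X) x (c : R) : S 0 ->
  (forall u, S u -> c <= `|x - u|) -> c <= dist_to S x.
Proof.
move=> S0 H; apply: lb_le_inf; first by exists `|x - 0|, 0.
by move=> _ [u Su <-]; exact: H.
Qed.

(** The distance to a subspace is sublinear, at most the norm and zero on the subspace; Hahn-Banach
    gives a linear functional below it that touches it at [x]. *)
Lemma separating_functional (S : set X) (x : X) : S 0 ->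
  (forall (a : R) u v, S u -> S v -> S (a *: u + v)) ->
  exists f, [/\ contraction_lin f, (forall u, S u -> f u = 0) &
    f x = dist_to S x].
Proof.
move=> S0 SL.
have SZ a u : S u -> S (a *: u) by move=> Su; rewrite -[_ *: _]addr0; apply: SL.
have SD u v : S u -> S v -> S (u + v).
  by move=> Su Sv; rewrite -[u]scale1r; apply: SL.
have sd : sublinear (dist_to S).
  split=> [y z|a y a0].
    suff : dist_to S (y + z) - dist_to S y <= dist_to S z by lra.
    apply: le_dist_to => // v Sv.
    suff : dist_to S (y + z) - `|z - v| <= dist_to S y by lra.
    apply: le_dist_to => // u Su.
    have := dist_to_le S (y + z) _ (SD _ _ Su Sv).
    by have := ler_normD (y - u) (z - v); rewrite addrACA -opprD; lra.
  have [->|an0] := eqVneq a 0.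
    by have := dist_to_le S 0 _ S0; rewrite scale0r mul0r subr0 normr0.
  have ap : 0 < a by rewrite lt_neqAle eq_sym an0.
  rewrite -ler_pdivrMl //; apply: le_dist_to => // u Su; rewrite ler_pdivrMl //.
  have := dist_to_le S (a *: y) _ (SZ a _ Su).
  by rewrite -scalerBr normrZ ger0_norm.
have [f [fL fle fx]] := hahn_banach x sd.
have fN y : f (- y) = - f y by rewrite -sub0r (linB fL) (lin0 fL) sub0r.
have dn y : dist_to S y <= `|y| by have := dist_to_le S y _ S0; rewrite subr0.
exists f; split=> //.
  split=> // y; rewrite ler_norml.
  have := le_trans (fle y) (dn y); have := le_trans (fle (- y)) (dn (- y)).
  by rewrite fN normrN => *; apply/andP; split; lra.
have d0 u : S u -> dist_to S u <= 0.
  by move=> Su; have := dist_to_le S u _ Su; rewrite subrr normr0.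
move=> u Su; have := le_trans (fle u) (d0 _ Su).
have SNu : S (- u) by rewrite -scaleN1r; exact: SZ.
by have := le_trans (fle (- u)) (d0 _ SNu); rewrite fN; lra.
Qed.

Lemma norming_functional (x : X) :
  exists f, contraction_lin f /\ f x = `|x|.
Proof.
have [||f [fc _ fx]] := separating_functional [set 0] x; first by [].
  by move=> a u v /= -> ->; rewrite scaler0 addr0.
exists f; split=> //; rewrite fx; apply/eqP; rewrite eq_le.
have := dist_to_le [set 0] x 0 erefl; rewrite subr0 => -> /=.
by apply: le_dist_to => // u ->; rewrite subr0.
Qed.

End Functionals.

(** * Recursive choice of sequences and subsequences *)

Section Sequences.

(** Dependent choice in which each term may depend on the whole list of earlier ones; the iteration
    runs on these lists. *)
Lemma history_choice {T : Type} (x0 : T) (P : seq T -> T -> Prop) :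
  (forall s, exists x, P s x) ->
  exists v : nat -> T, forall n, P (mkseq v n) (v n).
Proof.
move=> /choice[f Pf].
pose g n := iter n (fun s => rcons s (f s)) [::].
exists (fun n => f (g n)) => n; suff -> : mkseq (fun n => f (g n)) n = g n by [].
by elim: n => // n IH; rewrite mkseqS IH.
Qed.

Lemma subsequence_choice (P : nat -> nat -> Prop) :
  (forall j N, exists2 n, (N <= n)%N & P j n) ->
  exists phi : nat -> nat,
    (forall n, (phi n < phi n.+1)%N) /\ forall n, P n (phi n).
Proof.
move=> H.
have [phi Hphi] : exists phi : nat -> nat, forall n,
    (forall m, m \in mkseq phi n -> (m < phi n)%N) /\
    P (size (mkseq phi n)) (phi n).
  apply: (history_choice 0%N (fun s x => (forall m, m \in s -> (m < x)%N) /\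
    P (size s) x)) => s.
  (* Exceeding the maximum of all earlier indices makes the choice strictly increasing. *)
  have [n sn Pn] := H (size s) (\max_(m <- s) m).+1.
  exists n; split=> // m ms; apply: leq_trans sn; rewrite ltnS.
  by rewrite (big_rem m) //= leq_maxl.
exists phi; split=> n; last by have := (Hphi n).2; rewrite size_mkseq.
have := (Hphi n.+1).1 (phi n); apply.
by apply/mapP; exists n; rewrite ?mem_iota ?ltnS /=.
Qed.

Lemma subsequence_ge {phi : nat -> nat} :
  (forall n, (phi n < phi n.+1)%N) -> forall n, (n <= phi n)%N.
Proof. by move=> H; elim=> [//|n IH]; exact: leq_ltn_trans IH (H n). Qed.

Lemma exists_invn_lt {R : realType} (e : R) : 0 < e ->
  exists N, forall n, (N <= n)%N -> n.+1%:R^-1 < e.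
Proof.
by move=> e0; have [N _ HN] := near_infty_natSinv_lt (PosNum e0); exists N.
Qed.

End Sequences.

(** * Limits of ultrafilters with respect to a seminorm *)

Section Ultrafilter.
Context {R : realType} {X : zmodType}.

(* Used with the norm and with [fun x => `|f x|] for a functional [f]. *)
Lemma ultra_seminorm_limit (N : X -> R) (K : set X) (G : set_system X) :
  (forall x y, N (x + y) <= N x + N y) -> (forall x, N (- x) = N x) ->
  (forall v : nat -> X, (forall n, K (v n)) ->
    exists phi : nat -> nat, (forall n, (phi n < phi n.+1)%N) /\
    exists2 x, K x & forall e : R, 0 < e -> exists n0, forall n, (n0 <= n)%N ->
      N (v (phi n) - x) < e) ->
  UltraFilter G -> G K ->
  exists2 x, K x & forall e : R, 0 < e -> G [set y | N (y - x) < e].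
Proof.
move=> ND NN Kseq GU GK.
(* Total boundedness along [G]: if no ball of radius [e] centred in [K] belonged to [G], an
   [e]-separated sequence in [K] could be built. *)
have step e : 0 < e -> exists x, K x /\ G [set y | N (y - x) < e].
  move=> e0; apply: contrapT => /forallNP nex.
  have far x : K x -> G [set y | e <= N (y - x)].
    move=> Kx; have [Gx|] := in_ultra_setVsetC [set y | N (y - x) < e] GU.
      by exfalso; apply: (nex x).
    by apply: filterS => y /negP; rewrite /= -leNgt.
  have [v vP] : exists v : nat -> X, forall n,
      (forall y, y \in mkseq v n -> K y) ->
      K (v n) /\ forall y, y \in mkseq v n -> e <= N (v n - y).
    apply: (history_choice 0 (fun s x => (forall y, y \in s -> K y) ->
      K x /\ forall y, y \in s -> e <= N (x - y))) => s.
    have [Ks|nKs] := pselect (forall y, y \in s -> K y); last by exists 0.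
    suff : G [set x | forall y, y \in s -> e <= N (x - y)].
      by move=> /(filterI GK)/filter_ex[x [Kx xs]]; exists x.
    elim: s Ks => [|a s IH] Ks; first by apply: filterE => x y.
    have Gs : G [set x | forall y, y \in s -> e <= N (x - y)].
      by apply: IH => y ys; apply: Ks; rewrite in_cons ys orbT.
    have Ga := far a (Ks a (mem_head _ _)).
    apply: filterS (filterI Gs Ga) => x [xs xa] y.
    by rewrite in_cons => /orP[/eqP->|/xs].
  have Kv n : K (v n).
    elim/ltn_ind: n => n IH.
    suff /(vP n)[] : forall y, y \in mkseq v n -> K y by [].
    move=> y /mapP[m].
    by rewrite mem_iota /= => mn ->; exact: IH.
  have [phi [phiS [x Kx Hx]]] := Kseq v Kv.
  have [n0 Hn0] := Hx (e / 2) (divr_gt0 e0 (ltr0n _ 2)).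
  (* Two terms of the subsequence are [e] apart, yet both are within [e / 2] of [x]. *)
  have : e <= N (v (phi n0.+1) - v (phi n0)).
    have [|_] := vP (phi n0.+1); first by move=> y /mapP[m _ ->].
    by apply; apply/mapP; exists (phi n0); rewrite ?mem_iota ?phiS.
  have := Hn0 n0 (leqnn _); have := Hn0 n0.+1 (leqnSn _).
  have := ND (v (phi n0.+1) - x) (- (v (phi n0) - x)).
  rewrite NN opprB addrA subrK; lra.
(* Centres of balls in [G] with radii tending to zero; the limit of a subsequence of them is the
   required point. *)
have [v Hv] := choice (fun n => step n.+1%:R^-1 (ltac:(by rewrite invr_gt0 ltr0n))).
have [phi [phiS [x Kx Hx]]] := Kseq v (fun n => (Hv n).1).
exists x => // e e0; have e20 : 0 < e / 2 by lra.
have [n0 Hn0] := Hx _ e20; have [n1 Hn1] := exists_invn_lt _ e20.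
pose n := maxn n0 n1.
have h1 := Hn0 n (leq_maxl _ _).
have h2 := Hn1 (phi n) (leq_trans (leq_maxr _ _) (subsequence_ge phiS n)).
apply: filterS (Hv (phi n)).2 => y /= h3; have h4 := lt_trans h3 h2.
by have := ND (y - v (phi n)) (v (phi n) - x); rewrite addrA subrK; lra.
Qed.

End Ultrafilter.

(** * Concatenation of finite families *)

Section FiniteFamilies.
Context {T : Type}.

Definition ffnil (k : 'I_0) : T := False_rect T (notF (ltn_ord k)).

Definition fcat {m n} (f : 'I_m -> T) (g : 'I_n -> T) (i : 'I_(m + n)) : T :=
  match fintype.split i with inl j => f j | inr k => g k end.

Lemma fcat_lshift m n (f : 'I_m -> T) (g : 'I_n -> T) i :
  fcat f g (lshift n i) = f i.
Proof. by rewrite /fcat (unsplitK (inl i : 'I_m + 'I_n)). Qed.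

Lemma fcat_rshift m n (f : 'I_m -> T) (g : 'I_n -> T) i :
  fcat f g (rshift m i) = g i.
Proof. by rewrite /fcat (unsplitK (inr i : 'I_m + 'I_n)). Qed.

End FiniteFamilies.

(** * Norm and weak topologies, compactness and cluster points *)

Section Topologies.
Context {R : realType} {X : normedModType R}.
Implicit Types (t : topo) (U K C : set X).

Lemma tau_openT t : tau_open t (setT : set X).
Proof.
case: t => /=; first exact: openT.
by move=> x _; exists 0%N, (fun _ _ => 0); split=> [[]//|]; exists 1.
Qed.

Lemma tau_openI t U1 U2 : tau_open t U1 -> tau_open t U2 -> tau_open t (U1 `&` U2).
Proof.
case: t => /=; first exact: openI.
move=> o1 o2 x [/o1[m [f [fc [e1 e10 H1]]]] /o2[n [g [gc [e2 e20 H2]]]]].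
exists (m + n)%N, (fcat f g); split.
  move=> i; rewrite /fcat; case: fintype.split => j; [exact: fc|exact: gc].
exists (Num.min e1 e2); first by rewrite lt_min e10.
move=> y /= Hy; split; [apply: H1 => i|apply: H2 => i].
  by have := Hy (lshift n i); rewrite fcat_lshift lt_min => /andP[].
by have := Hy (rshift m i); rewrite fcat_rshift lt_min => /andP[].
Qed.

Lemma tau_open_bigI t (I : eqType) (s : seq I) (U : I -> set X) :
  (forall i, i \in s -> tau_open t (U i)) ->
  tau_open t [set x | forall i, i \in s -> U i x].
Proof.
elim: s => [|a s IH] H.
  by rewrite (_ : [set x | _] = setT); [exact: tau_openT|apply/seteqP; split].
rewrite (_ : [set x | _] = U a `&` [set x | forall i, i \in s -> U i x]).
  apply: tau_openI; first by apply: H; rewrite mem_head.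
  by apply: IH => i si; apply: H; rewrite in_cons si orbT.
apply/seteqP; split=> x /=.
  by move=> Hx; split=> [|i si]; apply: Hx; rewrite in_cons ?eqxx ?si ?orbT.
by move=> [Ua Us] i; rewrite in_cons => /orP[/eqP->|/Us].
Qed.

Lemma tau_open_local t U :
  (forall x, U x -> exists B, [/\ tau_open t B, B x & B `<=` U]) -> tau_open t U.
Proof.
case: t => /= H.
  rewrite openE => x /H[B [oB Bx BU]]; apply: filterS BU _.
  exact: open_nbhs_nbhs.
move=> x /H[B [oB Bx BU]]; have [n [f [fc [e e0 He]]]] := oB x Bx.
by exists n, f; split=> //; exists e => // y /He /BU.
Qed.

Lemma tau_open_translate t U (c : X) :
  tau_open t U -> tau_open t [set y | U (y - c)].
Proof.
case: t => /= oU.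
  rewrite (_ : [set y | _] = (fun y => y - c) @^-1` U) //.
  by apply: open_comp => // x _; apply: cvgB; [exact: cvg_id|exact: cvg_cst].
move=> x /oU[n [f [fc [e e0 He]]]]; exists n, f; split=> //; exists e => // y Hy.
by apply: He => i; rewrite /= opprB addrA subrK; exact: Hy.
Qed.

(** In the weak case this is lower semicontinuity of the norm: if [f] norms [x - a], then
    [f (y - a)] stays above [r] for [y] in a slab around [x]. *)
Lemma tau_open_norm_gt t (a : X) (r : R) : tau_open t [set x | r < `|x - a|].
Proof.
case: t => /=.
  rewrite (_ : [set x | _] = (fun y => `|y - a|) @^-1` [set s | r < s]) //.
  apply: open_comp => [x _|]; last exact: open_gt.
  apply: (@cvg_norm _ _ X _ _ (fun y => y - a)).
  by apply: cvgB; [exact: cvg_id|exact: cvg_cst].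
move=> x /= rx; have [f [[fL fle] fx]] := norming_functional (x - a).
exists 1%N, (fun _ => f); split; first by move=> _; exact: contraction_cont_lin.
exists (`|x - a| - r); first by lra.
move=> y /= /(_ ord0); rewrite -fx ltr_norml => /andP[h _].
apply: lt_le_trans (le_trans (ler_norm _) (fle _)).
have : f (y - a) = f (y - x) + f (x - a).
  by rewrite -[y - a](subrK (x - a)) -{1}[_ - (x - a)]scale1r fL mul1r opprB addrA subrK.
lra.
Qed.

Lemma tau_closed_cvg t C (u : nat -> X) x :
  tau_closed t C -> (forall n, C (u n)) -> tau_cvg t u x -> C x.
Proof.
move=> cC Cu ux; apply: contrapT => nCx.
by have [N _ /(_ N (leqnn _))] := ux _ cC nCx; apply.
Qed.

Definition tau_seq_compact t K : Prop :=
  forall v : nat -> X, (forall n, K (v n)) ->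
    exists phi : nat -> nat, (forall n, (phi n < phi n.+1)%N) /\
      exists2 x, K x & tau_cvg t (v \o phi) x.

(* [x] is a limit of every ultrafilter refining the filter generated by the
   complements of the members of a cover, hence lies in no member of it. *)
Lemma ultra_tau_compact t K :
  (forall G : set_system X, UltraFilter G -> G K ->
    exists2 x, K x & forall U, tau_open t U -> U x -> G U) ->
  tau_compact t K.
Proof.
move=> H I U oU KU; apply: contrapT => nfin.
(* Without a finite subcover these sets are nonempty, and concatenating families intersects them, so
   they generate a proper filter. *)
pose D n (g : 'I_n -> I) := [set x | K x /\ forall k, ~ U (g k) x].
pose F := [set B : set X | exists n (g : 'I_n -> I), D n g `<=` B].
have FF : ProperFilter F.
  apply: Build_ProperFilter_ex.
    move=> B [n [g DB]]; apply: contrapT => nB; apply: nfin; exists n, g => x Kx.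
    apply: contrapT => nU; apply: nB; exists x; apply: DB; split=> // k Uk.
    by apply: nU; exists k.
  split.
  - by exists 0%N, ffnil.
  - move=> B1 B2 [m [f D1]] [n [g D2]]; exists (m + n)%N, (fcat f g) => x [Kx Hx].
    split; [apply: D1|apply: D2]; split=> // k.
      by have := Hx (lshift n k); rewrite fcat_lshift.
    by have := Hx (rshift m k); rewrite fcat_rshift.
  - by move=> B1 B2 sB [n [g D1]]; exists n, g; exact: subset_trans sB.
have [G [GU FG]] := ultraFilterLemma FF.
have [|x Kx Hx] := H G GU.
  by apply: FG; exists 0%N, ffnil => x [].
have [i _ Uix] := KU x Kx.
have Gi := Hx _ (oU i) Uix.
have GnU : G (~` U i) by apply: FG; exists 1%N, (fun _ => i) => y [_ /(_ ord0)].
by have [y []] := filter_ex (filterI Gi GnU).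
Qed.

Definition tau_cluster t (v : nat -> X) (x : X) : Prop :=
  forall U, tau_open t U -> U x -> forall N, exists2 n, (N <= n)%N & U (v n).

(** Otherwise the open sets avoided by a tail of [v] cover [K]; finitely many suffice, and the term
    of [v] at the largest threshold escapes all of them. *)
Lemma tau_compact_cluster t K (v : nat -> X) :
  tau_compact t K -> (forall n, K (v n)) -> exists2 x, K x & tau_cluster t v x.
Proof.
move=> cK Kv; apply: contrapT => nex.
pose I := {p : set X * nat |
  tau_open t p.1 /\ forall n, (p.2 <= n)%N -> ~ p.1 (v n)}.
have [||n [g Hg]] := cK I (fun i => (sval i).1).
- by move=> [p []].
- move=> x Kx; apply: contrapT => nx; apply: nex; exists x => // U oU Ux N.
  apply: contrapT => nN; apply: nx.
  have HU : tau_open t U /\ forall n, (N <= n)%N -> ~ U (v n).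
    by split=> // n Nn Un; apply: nN; exists n.
  by exists (exist _ (U, N) HU).
pose N := \max_(k < n) (sval (g k)).2.
have [k Uk] := Hg _ (Kv N).
by apply: (svalP (g k)).2 Uk; exact: (leq_bigmax k).
Qed.

End Topologies.

(** * Compactness and sequential compactness: the Eberlein-Smulian theorem *)

Section EberleinSmulian.
Context {R : realType} {X : normedModType R}.
Implicit Types (v : nat -> X) (K U : set X).

Lemma invn_gt0 n : 0 < n.+1%:R^-1 :> R.
Proof. by rewrite invr_gt0 ltr0n. Qed.

(** Continuity at [0] bounds [f] by [1] on a ball of radius [d]; evaluation at a multiple of [x] of
    norm [d / 2] gives [c = d / 2]. *)
Lemma cont_lin_scaled (f : X -> R) : cont_lin f ->
  exists2 c : R, 0 < c & contraction_lin (fun x => c * f x).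
Proof.
move=> [fL fC]; have /cvgrPdist_lt/(_ 1 ltr01)/nbhs_ballP[d /= d0 Hd] := fC 0.
exists (d / 2); first lra.
split=> [a x y|x]; first by rewrite fL; lra.
have [->|x0] := eqVneq x 0; first by rewrite (lin0 fL) mulr0 !normr0.
have nx : 0 < `|x| by rewrite normr_gt0.
have := Hd ((d / 2 / `|x|) *: x); rewrite -ball_normE /= sub0r normrN normrZ.
rewrite gtr0_norm; last by rewrite !divr_gt0.
rewrite divfK ?gt_eqF // => /(_ (ltac:(lra))).
have -> : f ((d / 2 / `|x|) *: x) = d / 2 / `|x| * f x.
  by rewrite -[_ *: x]addr0 fL (lin0 fL) addr0.
rewrite (lin0 fL) sub0r normrN => H; apply: ltW.
have -> : d / 2 * f x = d / 2 / `|x| * f x * `|x|.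
  by rewrite [RHS]mulrAC divfK ?gt_eqF.
by rewrite normrM normr_id gtr_pMl.
Qed.

Lemma weak_open_slab (f : X -> R) (x : X) (e : R) :
  cont_lin f -> weak_open [set y | `|f (y - x)| < e].
Proof.
move=> fc; have fL := fc.1; move=> y /= ye.
exists 1%N, (fun _ => f); split=> //; exists (e - `|f (y - x)|); first by rewrite subr_gt0.
move=> w /= /(_ ord0); have := ler_normD (f (w - y)) (f (y - x)).
by rewrite !(linB fL) addrA subrK; lra.
Qed.

(** Rational coefficients keep these combinations countable, so that they can be coded by natural
    numbers. *)
Definition comb (q : seq (rat * nat)) v : X := \sum_(p <- q) ratr p.1 *: v p.2.

Lemma eq_comb q v w : (forall p, p \in q -> v p.2 = w p.2) -> comb q v = comb q w.
Proof. by move=> H; apply: eq_big_seq => p /H->. Qed.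

Inductive spanned v : set X :=
| spanned0 : spanned v 0
| spannedD (a : R) i y : spanned v y -> spanned v (a *: v i + y).

Lemma spanned_linear v (a : R) x y :
  spanned v x -> spanned v y -> spanned v (a *: x + y).
Proof.
move=> vx vy; elim: vx => [|b i z _ IH]; first by rewrite scaler0 add0r.
by rewrite scalerDr scalerA -addrA; apply: spannedD.
Qed.

Lemma spanned_comb v x (e : R) : spanned v x -> 0 < e ->
  exists q, `|x - comb q v| < e.
Proof.
move=> vx; elim: vx e => [|a i y _ IH] e e0.
  by exists [::]; rewrite /comb big_nil subrr normr0.
have e20 : 0 < e / 2 by lra.
have [q Hq] := IH _ e20.
(* Tolerance on the coefficient; the added [1] covers the case [v i = 0]. *)
have d0 : 0 < e / 2 / (`|v i| + 1).
  by rewrite divr_gt0 // ltr_wpDl.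
have ad : a < a + e / 2 / (`|v i| + 1) by rewrite ltrDl.
have [r] := rat_in_itvoo ad.
rewrite in_itv /= => /andP[r1 r2].
exists ((r, i) :: q); rewrite /comb big_cons -/(comb q v) /= opprD addrACA -scalerBl.
apply: le_lt_trans (ler_normD _ _) _; rewrite normrZ.
have : `|a - ratr r| * `|v i| <= e / 2; last lra.
have : `|a - ratr r| <= e / 2 / (`|v i| + 1).
  by rewrite ler0_norm; lra.
rewrite ler_pdivlMr ?ltr_wpDl //; apply: le_trans.
by rewrite ler_wpM2l // lerDl.
Qed.

(* Mazur: otherwise a functional would separate [x] from the span of the [v n]. *)
Lemma weak_cluster_comb v x (e : R) : tau_cluster WeakTop v x -> 0 < e ->
  exists q, `|x - comb q v| < e.
Proof.
move=> vx e0; have e20 : 0 < e / 2 by lra.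
have [f [fc f0 fx]] := separating_functional (spanned v) x (spanned0 v) (spanned_linear v).
have [u vu xu] : exists2 u, spanned v u & `|x - u| < e / 2.
  apply: contrapT => nex.
  have : e / 2 <= dist_to (spanned v) x.
    apply: le_dist_to; first exact: spanned0.
    by move=> u vu; rewrite leNgt; apply/negP => xu; apply: nex; exists u.
  rewrite -fx => efx.
  have xs : `|f (x - x)| < e / 2 by rewrite subrr (lin0 fc.1) normr0.
  (* The slab around [x] contains some [v n], but [f] vanishes there and is at least [e / 2] at
     [x]. *)
  have [n _] := vx _ (weak_open_slab f x (e / 2) (contraction_cont_lin _ fc)) xs 0%N.
  rewrite /= (linB fc.1) (f0 (v n)); last first.
    by rewrite -[v n]addr0 -[v n]scale1r; apply: spannedD; exact: spanned0.
  by rewrite sub0r normrN => /(le_lt_trans (ler_norm _)); lra.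
have [q Hq] := spanned_comb v u _ vu e20.
exists q; have := ler_normD (x - u) (u - comb q v); rewrite addrA subrK; lra.
Qed.

Lemma tau_cluster_sub t v (phi : nat -> nat) x :
  (forall n, (n <= phi n)%N) -> tau_cluster t (v \o phi) x -> tau_cluster t v x.
Proof.
move=> phin vx U oU Ux N; have [n Nn Un] := vx U oU Ux N.
by exists (phi n) => //; exact: leq_trans (phin n).
Qed.

Lemma tau_cvg_cluster t v x : tau_cvg t v x -> tau_cluster t v x.
Proof.
move=> vx U oU Ux N; have [M _ HM] := vx U oU Ux.
by exists (maxn N M); [exact: leq_maxl|apply: HM; exact: leq_maxr].
Qed.

Lemma le_eps_eq0 (r : R) : (forall e : R, 0 < e -> `|r| < e) -> r = 0.
Proof.
move=> H; apply/eqP; rewrite -normr_le0 leNgt; apply/negP => /H.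
by rewrite ltxx.
Qed.

Lemma weak_slab_cvg v (f : X -> R) x (e : R) : cont_lin f -> tau_cvg WeakTop v x ->
  0 < e -> exists N, forall n, (N <= n)%N -> `|f (v n - x)| < e.
Proof.
move=> fc vx e0.
have xs : `|f (x - x)| < e by rewrite subrr (lin0 fc.1) normr0.
have [N _ HN] := vx _ (weak_open_slab f x e fc) xs.
by exists N => n Nn; exact: HN.
Qed.

(* Whitley's argument.  [z] is the limit of the evaluations along [G].  The
   sequence [v] in [K] is chosen so that, on countably many functionals [Phi u m]
   detecting up to [1/(m+1)] the distance from [z] to the rational combinations
   [u] of [v], the values along [v] tend to [z]; the weak limit of a subsequence
   lies in the closure of these combinations, so it represents [z]. *)
Lemma weak_seq_compact_ultra K (G : set_system X) :
  tau_seq_compact WeakTop K -> UltraFilter G -> G K ->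
  exists2 x, K x & forall U, weak_open U -> U x -> G U.
Proof.
move=> Kseq GU GK.
(* [z f] is the limit of [f] along [G]; the value [0] is a placeholder when [f] is not continuous
   linear. *)
have /choice[z Hz] : forall f : X -> R, exists r : R, cont_lin f ->
    forall e : R, 0 < e -> G [set y | `|f y - r| < e].
  move=> f; have [fc|nfc] := pselect (cont_lin f); last by exists 0.
  have fL := fc.1.
  have fD a b : `|f (a + b)| <= `|f a| + `|f b|.
    by rewrite -[a]scale1r fL mul1r scale1r ler_normD.
  have fN a : `|f (- a)| = `|f a| by rewrite -sub0r (linB fL) (lin0 fL) sub0r normrN.
  have [v Kv|x Kx Hx] := ultra_seminorm_limit (fun x => `|f x|) K G fD fN _ GU GK.
    have [phi [phiS [x Kx vx]]] := Kseq v Kv.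
    exists phi; split=> //; exists x => // e e0; exact: weak_slab_cvg fc vx e0.
  by exists (f x) => _ e /Hx; apply: filterS => y; rewrite /= (linB fL).
have /choice[Phi HPhi] : forall um : X * nat, exists f : X -> R, contraction_lin f /\
    forall psi, contraction_lin psi -> um.2.+1%:R^-1 <= `|z psi - psi um.1| ->
      um.2.+1%:R^-1 <= `|z f - f um.1|.
  move=> [u m] /=.
  have [[f [fc Hf]]|nf] := pselect (exists f, contraction_lin f /\
      m.+1%:R^-1 <= `|z f - f u|); first by exists f.
  (* No functional detects such a gap, so any contraction will do. *)
  have [f [fc _]] := norming_functional (0 : X).
  by exists f; split=> // psi psic H; exfalso; apply: nf; exists psi.
have zcvg um (e : R) : 0 < e -> G [set y | `|Phi um y - z (Phi um)| < e].
  by apply: Hz; exact: contraction_cont_lin (HPhi um).1.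
(* [v n] nearly attains [z] on the functionals with code below [n]; combinations are formed from the
   earlier terms, with [0] for missing ones. *)
have [v vP] : exists v : nat -> X, forall n, K (v n) /\
    forall k : 'I_(size (mkseq v n)), forall (q : seq (rat * nat)) (m : nat),
      choice.unpickle k = Some (q, m) ->
    let f := Phi (comb q (nth 0 (mkseq v n)), m) in
    `|f (v n) - z f| < (size (mkseq v n)).+1%:R^-1.
  apply: (history_choice 0 (fun s x => K x /\
    forall k : 'I_(size s), forall (q : seq (rat * nat)) (m : nat),
      choice.unpickle k = Some (q, m) ->
    let f := Phi (comb q (nth 0 s), m) in `|f x - z f| < (size s).+1%:R^-1)) => s.
  have Gk (k : 'I_(size s)) : G [set x | forall (q : seq (rat * nat)) (m : nat),
      choice.unpickle k = Some (q, m) ->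
      let f := Phi (comb q (nth 0 s), m) in `|f x - z f| < (size s).+1%:R^-1].
    case: (choice.unpickle k) => [[q m]|]; last by apply: filterE.
    apply: filterS (zcvg (comb q (nth 0 s), m) _ (invn_gt0 (size s))).
    by move=> x /= Hx _ _ [<- <-].
  have GF : Filter G by exact: _.
  have /filter_ex[x [Kx Hx]] := @filterI _ G GF _ _ GK (filter_forall GF Gk).
  by exists x; split=> // k; exact: Hx.
have [phi [phiS [x Kx vx]]] := Kseq v (fun n => (vP n).1).
have vcl : tau_cluster WeakTop v x.
  apply: (tau_cluster_sub _ _ phi _ (subsequence_ge phiS)).
  exact: tau_cvg_cluster vx.
have zPhi q m : z (Phi (comb q v, m)) = Phi (comb q v, m) x.
  set f := Phi _; have fc : contraction_lin f := (HPhi _).1.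
  apply/eqP; rewrite -subr_eq0; apply/eqP/le_eps_eq0 => e e0.
  have e20 : 0 < e / 2 by lra.
  have [N HN] := weak_slab_cvg _ f x _ (contraction_cont_lin _ fc) vx e20.
  have [M HM] := exists_invn_lt _ e20.
  (* From [B] on, the code of [(q, m)] has been treated and all indices in [q] lie in the history,
     so the default [0] never enters. *)
  pose B := maxn (choice.pickle (q, m)).+1 (\max_(p <- q) p.2).+1.
  pose n := maxn N (maxn M B).
  have phin : (n <= phi n)%N := subsequence_ge phiS n.
  have h1 : `|f (v (phi n) - x)| < e / 2 by apply: HN; rewrite leq_maxl.
  have h2 : (phi n).+1%:R^-1 < e / 2.
    by apply: HM; apply: leq_trans phin; exact: leq_trans (leq_maxl M B) (leq_maxr N _).
  have Bn : (B <= phi n)%N.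
    by apply: leq_trans phin; exact: leq_trans (leq_maxr M B) (leq_maxr N _).
  have kn : (choice.pickle (q, m) < size (mkseq v (phi n)))%N.
    by rewrite size_mkseq; apply: leq_trans Bn; exact: leq_maxl.
  have := (vP (phi n)).2 (Ordinal kn) q m (choice.pickleK _).
  have -> : comb q (nth 0 (mkseq v (phi n))) = comb q v.
    apply: eq_comb => p pq; apply: nth_mkseq; apply: leq_trans Bn.
    apply: leq_trans (leq_maxr _ _); rewrite ltnS (big_rem p) //=; exact: leq_maxl.
  rewrite /= -/f size_mkseq => h3; move: h1 h2 h3; rewrite (linB fc.1) => h1 h2 h3.
  have := ler_normB (f (v (phi n)) - f x) (f (v (phi n)) - z f).
  have -> : f (v (phi n)) - f x - (f (v (phi n)) - z f) = z f - f x by lra.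
  move: (lt_trans h3 h2); lra.
have zx psi : contraction_lin psi -> z psi = psi x.
  move=> psic; apply/eqP; rewrite -subr_eq0; apply/eqP/le_eps_eq0 => e e0.
  have e20 : 0 < e / 2 by lra.
  have [m Hm] := exists_invn_lt _ e20; have {}Hm := Hm m (leqnn m).
  have [q Hq] := weak_cluster_comb v x _ vcl (invn_gt0 m).
  (* A larger gap at [psi] would force one at [Phi]; there [z] is evaluation at [x], and a
     contraction cannot exceed the distance from [x] to the combination. *)
  have h1 : `|z psi - psi (comb q v)| < m.+1%:R^-1.
    rewrite ltNge; apply/negP => /((HPhi (comb q v, m)).2 psi psic) /=.
    rewrite zPhi -(linB (HPhi _).1.1); apply/negP; rewrite -ltNge.
    exact: le_lt_trans ((HPhi _).1.2 _) Hq.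
  have h2 : `|psi (comb q v) - psi x| < m.+1%:R^-1.
    by rewrite distrC -(linB psic.1); exact: le_lt_trans (psic.2 _) Hq.
  have := ler_normD (z psi - psi (comb q v)) (psi (comb q v) - psi x).
  rewrite addrA subrK; move: (lt_trans h1 Hm) (lt_trans h2 Hm); lra.
(* A basic weak neighbourhood involves finitely many functionals; each is rescaled to a contraction,
   on which [z] is evaluation at [x]. *)
exists x => // U oU Ux; have [n [f [fc [e e0 He]]]] := oU x Ux.
suff Gi i : G [set y | `|f i (y - x)| < e].
  have GF : Filter G by exact: _.
  by apply: (@filterS _ G GF _ _ _ (filter_forall GF Gi)) => y; exact: He.
have [c c0 cc] := cont_lin_scaled _ (fc i).
have := Hz _ (contraction_cont_lin _ cc) _ (mulr_gt0 c0 e0).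
apply: filterS => y /=; rewrite (zx _ cc) -mulrBr -(linB (fc i).1) normrM.
by rewrite gtr0_norm // ltr_pM2l.
Qed.

Lemma norm_seq_compact_ultra K (G : set_system X) :
  tau_seq_compact NormTop K -> UltraFilter G -> G K ->
  exists2 x, K x & forall U, open U -> U x -> G U.
Proof.
move=> Kseq GU GK.
have [v Kv|x Kx Hx] :=
    ultra_seminorm_limit (fun x => `|x|) K G (@ler_normD _ _) (@normrN _ _) _ GU GK.
  have [phi [phiS [x Kx vx]]] := Kseq v Kv.
  exists phi; split=> //; exists x => // e e0.
  have [N _ HN] : \forall n \near \oo, ball x e (v (phi n)).
    by apply: vx; [exact: ball_open|exact: ballxx].
  by exists N => n /HN; rewrite -ball_normE /= distrC.
exists x => // U oU Ux.
have /nbhs_ballP[e /= e0 He] : nbhs x U by exact: open_nbhs_nbhs.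
apply: filterS (Hx e e0) => y /= ye; apply: He.
by rewrite -ball_normE /= distrC.
Qed.

Lemma tau_seq_compact_compact t K : tau_seq_compact t K -> tau_compact t K.
Proof.
move=> Kseq; apply: ultra_tau_compact => G GU GK.
case: t Kseq => Kseq; [exact: norm_seq_compact_ultra|exact: weak_seq_compact_ultra].
Qed.

Lemma norm_compact_seq_compact K :
  tau_compact NormTop K -> tau_seq_compact NormTop K.
Proof.
move=> cK v Kv; have [x Kx vx] := tau_compact_cluster _ _ _ cK Kv.
have [phi [phiS Hphi]] : exists phi : nat -> nat, (forall n, (phi n < phi n.+1)%N) /\
    forall n, ball x (n.+1%:R^-1 : R) (v (phi n)).
  apply: (subsequence_choice (fun j n => ball x (j.+1%:R^-1 : R) (v n))) => j N.
  by apply: vx; [apply: ball_open|apply: ballxx]; exact: invn_gt0.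
exists phi; split=> //; exists x => // U oU Ux.
have /nbhs_ballP[e /= e0 He] : nbhs x U by exact: open_nbhs_nbhs.
have [N HN] := exists_invn_lt _ e0; exists N => // n /= /HN ne; apply: He.
exact: le_ball (ltW ne) _ (Hphi n).
Qed.

(** Countably many functionals norm the differences of rational combinations of [v]. A diagonal
    subsequence tends to the cluster point [x] along all of them. Any cluster point of a further
    subsequence agrees with [x] under these functionals and lies, like [x], in the norm closure of
    the combinations, so it equals [x]. *)
Lemma weak_compact_seq_compact K :
  tau_compact WeakTop K -> tau_seq_compact WeakTop K.
Proof.
move=> cK v Kv; have [x Kx vx] := tau_compact_cluster _ _ _ cK Kv.
have [g Hg] := choice (@norming_functional R X).
pose f k : X -> R :=
  if choice.unpickle k is Some (q1, q2) then g (comb q1 v - comb q2 v) else g 0.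
have fc k : contraction_lin (f k).
  by rewrite /f; case: (choice.unpickle k) => [[q1 q2]|]; exact: (Hg _).1.
have [phi [phiS Hphi]] : exists phi : nat -> nat, (forall n, (phi n < phi n.+1)%N) /\
    forall n, forall k, k \in iota 0 n -> `|f k (v (phi n) - x)| < n.+1%:R^-1.
  apply: (subsequence_choice (fun j n => forall k, k \in iota 0 j ->
    `|f k (v n - x)| < j.+1%:R^-1)) => j N.
  pose S k := [set y | `|f k (y - x)| < j.+1%:R^-1].
  have oS : tau_open WeakTop [set y | forall k, k \in iota 0 j -> S k y].
    apply: tau_open_bigI => k _; apply: weak_open_slab; exact: contraction_cont_lin.
  have [|n Nn Sn] := vx _ oS _ N; last by exists n.
  by move=> k _; rewrite /S /= subrr (lin0 (fc k).1) normr0 invn_gt0.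
exists phi; split=> //; exists x => // U oU Ux; apply: contrapT => nU.
(* Failure of convergence leaves a further subsequence outside [U], whose cluster points cannot be
   [x]. *)
have [psi [psiS Hpsi]] : exists psi : nat -> nat, (forall n, (psi n < psi n.+1)%N) /\
    forall n, ~ U (v (phi (psi n))).
  apply: (subsequence_choice (fun _ n => ~ U (v (phi n)))) => _ N.
  apply: contrapT => nN; apply: nU; exists N => // n /= Nn.
  by apply: contrapT => nUn; apply: nN; exists n.
have [x' Kx' wx'] := tau_compact_cluster _ _ (v \o (phi \o psi)) cK (fun n => Kv _).
suff xx' : x' = x.
  by rewrite xx' in wx'; have [n _ /Hpsi] := wx' U oU Ux 0%N.
have fxx' k : f k (x' - x) = 0.
  apply: le_eps_eq0 => e e0; have e20 : 0 < e / 2 by lra.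
  have [M HM] := exists_invn_lt _ e20.
  have xs : `|f k (x' - x')| < e / 2 by rewrite subrr (lin0 (fc k).1) normr0.
  have [n nN h1] := wx' _ (weak_open_slab (f k) x' _ (contraction_cont_lin _ (fc k)))
    xs (maxn k.+1 M).
  move: nN; rewrite geq_max => /andP[kn Mn].
  have npsi := subsequence_ge psiS n.
  have h2 : `|f k (v (phi (psi n)) - x)| < (psi n).+1%:R^-1.
    by apply: Hphi; rewrite mem_iota /= (leq_trans kn).
  have h3 := HM _ (leq_trans Mn npsi).
  have := ler_normB (f k (v (phi (psi n)) - x)) (f k (v (phi (psi n)) - x')).
  have -> : f k (v (phi (psi n)) - x) - f k (v (phi (psi n)) - x') = f k (x' - x).
    by rewrite !(linB (fc k).1); lra.
  rewrite /= in h1.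
  move: (lt_trans h2 h3); lra.
have vx' : tau_cluster WeakTop v x'.
  apply: tau_cluster_sub wx' => n.
  exact: leq_trans (subsequence_ge psiS n) (subsequence_ge phiS _).
apply/eqP; rewrite -subr_eq0 -normr_eq0; apply/eqP/le_eps_eq0 => e e0.
rewrite normr_id.
have e40 : 0 < e / 4 by lra.
have [q1 h1] := weak_cluster_comb v x' _ vx' e40.
have [q2 h2] := weak_cluster_comb v x _ vx e40.
have := fxx' (choice.pickle (q1, q2)); rewrite /f choice.pickleK.
set u := comb q1 v - comb q2 v; have [[hL hle] hu] := Hg u => h0.
have d : `|x' - x - u| < e / 2.
  have := ler_normB (x' - comb q1 v) (x - comb q2 v).
  have -> : x' - comb q1 v - (x - comb q2 v) = x' - x - u.
    by rewrite /u !opprD addrACA.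
  lra.
(* The functional norming [u] vanishes at [x' - x] by [h0], so [u] is no longer than [x' - x - u];
   two bounds of [e / 2] then add up. *)
have : `|u| <= `|x' - x - u|.
  rewrite -hu; apply: le_trans (hle _); rewrite (linB hL (x' - x) u) h0 sub0r normrN.
  exact: ler_norm.
have := ler_normD (x' - x - u) u; rewrite subrK; lra.
Qed.

Lemma tau_compact_seq_compact t K : tau_compact t K -> tau_seq_compact t K.
Proof.
case: t; [exact: norm_compact_seq_compact|exact: weak_compact_seq_compact].
Qed.

End EberleinSmulian.

(** * Lower semicontinuity of [rf f] and minimizing sequences *)

Section Centers.
Context {R : realType} {X : normedModType R}.
Implicit Types (V : set X) (F : {fset X}).

Lemma nonneg_dist F (x : X) : nonneg_vec (fun a : F => `|x - val a|).
Proof. by move=> a. Qed.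

(* By convexity [s |-> f (s p)] is continuous at [s = 1]; if each distance from
   [y] to [a \in F] exceeds [s] times the one from [x], monotonicity gives
   [rf f y >= f (s p)]. *)
Lemma tau_open_rf_gt t F (f : (F -> R) -> R) (c : R) :
  cm_fun f -> tau_open t [set x : X | c < rf f x].
Proof.
move=> [f0 fmono fconv]; apply: tau_open_local => x /= cx.
pose p (a : F) := `|x - val a|.
have p0 : nonneg_vec p := nonneg_dist F x.
have p2 : nonneg_vec (fun a => 2 * p a) by move=> a; rewrite mulr_ge0.
have [s [s0 s1 Hs]] : exists s : R, [/\ 0 < s, s < 1 & c < f (fun a => s * p a)].
  set A := f p; set B := f (fun a => 2 * p a).
  have AB : A <= B by apply: fmono => // a; have := p0 a; lra.
  have cA : c < A := cx.
  (* Small enough that convexity, bounding [A] by [(1 - d / 2) * f (s p) + (d / 2) * B], forces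
     [f (s p) > c]. *)
  have [d [d0 d1 Hd]] : exists d : R, [/\ 0 < d, d < 1 & d * (B - c) < A - c].
    pose D := B - c + (A - c).
    have D0 : 0 < D by rewrite /D; lra.
    exists ((A - c) / D); rewrite divr_gt0 ?subr_gt0 // ltr_pdivrMr //.
    rewrite mul1r mulrAC ltr_pdivrMr // ltr_pM2l ?subr_gt0 //.
    by split=> //; rewrite /D; lra.
  (* chosen so that [p = (1 - d / 2) (s p) + (d / 2) (2 p)] *)
  pose s := (1 - d) / (1 - d / 2).
  have h0 : 0 < 1 - d / 2 by lra.
  exists s; split; first by rewrite divr_gt0 //; lra.
    by rewrite ltr_pdivrMr //; lra.
  have sp0 : nonneg_vec (fun a => s * p a).
    by move=> a; rewrite mulr_ge0 // divr_ge0 //; lra.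
  have := fconv _ _ (1 - d / 2) sp0 p2 (ltac:(lra)).
  have -> : (fun a => (1 - d / 2) * (s * p a) + (1 - (1 - d / 2)) * (2 * p a)) = p.
    apply/funext => a; rewrite mulrA [(1 - d / 2) * s]mulrC /s divfK ?gt_eqF //; lra.
  rewrite -/A -/B => H; rewrite -(ltr_pM2l h0); have := mulr_gt0 d0; nra.
(* Where [p a = 0] the strict inequality fails at [x] itself, but the weak bound used below is then
   trivial. *)
pose S a := [set y : X | p a = 0 \/ s * p a < `|y - val a|].
have oS a : tau_open t (S a).
  have [pa0|pa0] := eqVneq (p a) 0.
    have -> : S a = setT by apply/seteqP; split=> // y _; left.
    exact: tau_openT.
  have -> : S a = [set y : X | s * p a < `|y - val a|].
    by apply/seteqP; split=> y /=; [case=> // /eqP; rewrite (negbTE pa0)|right].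
  exact: tau_open_norm_gt.
exists [set y | forall a, a \in enum {: F} -> S a y]; split.
- by apply: tau_open_bigI => a _; exact: oS.
- move=> a _; have [pa0|pa0] := eqVneq (p a) 0; [by left|right].
  by rewrite gtr_pMl // lt_neqAle eq_sym pa0 p0.
- move=> y Uy; apply: lt_le_trans Hs _; apply: fmono; last first.
  + move=> a; have [->|/ltW //] := Uy a (mem_enum predT a).
    by rewrite mulr0.
  + exact: nonneg_dist.
  + by move=> a; rewrite mulr_ge0 // ltW.
Qed.

Lemma rad_le V F (f : (F -> R) -> R) v : cm_fun f -> V v -> Defs.rad V f <= rf f v.
Proof.
move=> [f0 _ _] Vv; apply: ge_inf; last by exists v.
by exists 0 => _ [w _ <-]; apply: f0; exact: nonneg_dist.
Qed.

Lemma cm_fun0 F : cm_fun (fun _ : F -> R => 0 : R).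
Proof. by split=> // *; rewrite !mulr0 addr0. Qed.

(** Through this choice of function, compactness of centre sets becomes compactness of [V]. *)
Lemma Cent0 V F : Cent V (fun _ : F -> R => 0) = V.
Proof.
apply/seteqP; split=> [v []//|v Vv]; split=> //.
apply/eqP; rewrite eq_le (rad_le V F _ v (cm_fun0 F) Vv) andbT.
by apply: lb_le_inf; [exists 0, v|move=> _ [w _ <-]].
Qed.

(** If [rf f x] exceeded the radius, lower semicontinuity would keep [rf f (v n)] eventually above
    the midpoint [c], against minimization. *)
Lemma minimizing_cvg_Cent t V F (f : (F -> R) -> R) v x : cm_fun f ->
  tau_closed t V -> (forall n, V (v n)) ->
  (fun n => rf f (v n)) @ \oo --> Defs.rad V f -> tau_cvg t v x -> Cent V f x.
Proof.
move=> fcm cV Vv fv vx; have Vx := tau_closed_cvg _ _ _ _ cV Vv vx.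
split=> //; apply/eqP; rewrite eq_le rad_le // andbT leNgt; apply/negP => lt_rad.
pose c := (Defs.rad V f + rf f x) / 2.
have cx : c < rf f x by rewrite /c; lra.
have [N _ HN] := vx _ (tau_open_rf_gt t F f c fcm) cx.
have c0 : 0 < c - Defs.rad V f by rewrite /c; lra.
move/cvgrPdist_lt/(_ _ c0) : fv => [M _ HM].
have := HN _ (leq_maxl N M); have := HM _ (leq_maxr N M).
by rewrite /= distrC => /(le_lt_trans (ler_norm _)); lra.
Qed.

Lemma dCent_minimizing V F (f : (F -> R) -> R) v : cm_fun f ->
  (forall n, dCent V f n.+1%:R^-1 (v n)) ->
  (fun n => rf f (v n)) @ \oo --> Defs.rad V f.
Proof.
move=> fcm Hv; apply/cvgrPdist_lt => e e0.
have [N HN] := exists_invn_lt _ e0; exists N => // n /= Nn.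
have [Vn le_n] := Hv n.
rewrite distrC ger0_norm ?subr_ge0; last exact: rad_le.
rewrite ltrBlDl; apply: le_lt_trans le_n _; rewrite ltrD2l; exact: HN.
Qed.

Lemma dCent_nonempty V F (f : (F -> R) -> R) (d : R) : V !=set0 -> 0 < d ->
  dCent V f d !=set0.
Proof.
move=> [v0 V0] d0; apply: contrapT => ne.
have : Defs.rad V f + d <= Defs.rad V f; last lra.
apply: lb_le_inf; first by exists (rf f v0), v0.
move=> _ [v Vv <-]; rewrite leNgt; apply/negP => lt_v; apply: ne.
by exists v; split=> //; exact: ltW.
Qed.

End Centers.

(** * Equivalence of SACP with property (P1) and compact centres *)

Theorem theorem2p2 (R : realType) (X : completeNormedModType R) (t : topo)
  (V : set X) (A : set {fset X}) :
  tau_closed t V -> V !=set0 -> (forall F, A F -> F != fset0) ->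
  (SACP t V A <->
   (P1 t V A /\
    forall F, A F -> forall f : (F -> R) -> R, cm_fun f ->
      tau_compact t (Cent V f))).
Proof.
move=> cV V0 _; split=> [sacp|[_ Ccomp] F AF f fcm v Vv _]; last first.
  (* With the zero function, [V] is compact, hence sequentially compact, so any sequence in it will
     do. *)
  have := Ccomp F AF _ (cm_fun0 F); rewrite Cent0 => cptV.
  have [phi [phiS [x _ vx]]] := tau_compact_seq_compact t V cptV v Vv.
  by exists phi; split=> //; exists x.
(* SACP strengthened: the limit of the subsequence is a centre. *)
have sub (F : {fset X}) (f : (F -> R) -> R) (v : nat -> X) :
    A F -> cm_fun f -> (forall n, V (v n)) ->
    (fun n => rf f (v n)) @ \oo --> Defs.rad V f ->
    exists phi : nat -> nat, (forall n, (phi n < phi n.+1)%N) /\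
    exists2 x, Cent V f x & tau_cvg t (v \o phi) x.
  move=> AF fcm Vv fv; have [phi [phiS [x vx]]] := sacp F AF f fcm v Vv fv.
  exists phi; split=> //; exists x => //.
  apply: minimizing_cvg_Cent vx => // [n|]; first exact: Vv.
  apply: cvg_comp fv => B [N _ HN]; exists N => // n /= Nn; apply: HN => /=.
  exact: leq_trans Nn (subsequence_ge phiS n).
split=> [F AF f fcm|F AF f fcm]; last first.
  apply: tau_seq_compact_compact => v Cv; apply: sub => // [n|]; first exact: (Cv n).1.
  (* A sequence of centres is minimizing because its values are constant. *)
  rewrite (_ : (fun n => rf f (v n)) = fun=> Defs.rad V f); first exact: cvg_cst.
  by apply/funext => n; exact: (Cv n).2.
split=> [|W [U [oU U0 UW]]].
  have [v Hv] := choice (fun n => dCent_nonempty V F f _ V0 (invn_gt0 n)).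
  have [||phi [_ [x Cx _]]] := sub F f v AF fcm; last by exists x.
    by move=> n; exact: (Hv n).1.
  exact: dCent_minimizing.
apply: contrapT => nd.
(* If no [d] works, points of the [1 / (n + 1)]-centre sets outside [Cent V f + W] form a minimizing
   sequence, and a subsequence tends to a centre [x]. *)
have far n : exists v, dCent V f n.+1%:R^-1 v /\
    ~ exists c w, [/\ Cent V f c, W w & v = c + w].
  apply: contrapT => nv; apply: nd; exists n.+1%:R^-1; first exact: invn_gt0.
  by move=> v dv; apply: contrapT => nW; apply: nv; exists v.
have [v Hv] := choice far.
have [||phi [_ [x Cx vx]]] := sub F f v AF fcm.
- by move=> n; exact: (Hv n).1.1.
- by apply: dCent_minimizing => // n; exact: (Hv n).1.
have Ux : U (x - x) by rewrite subrr.
(* Eventually the differences from [x] lie in [U], which puts a term of the subsequence in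
   [Cent V f + W]. *)
have [N _ /(_ N (leqnn N)) /= UN] := vx _ (tau_open_translate t U x oU) Ux.
apply: (Hv (phi N)).2; exists x, (v (phi N) - x); split=> //; first exact: UW.
by rewrite addrC subrK.
Qed.
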